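(* Let $(X,\rho)$ be a Hadamard space, let $K \subset X$ be nonempty, compact and convex, and let $F : K\times K \to \mathbb{R}$ be a bifunction satisfying: (A1) $F(x,x) \geq 0$ for each $x\in K$; (A2) for every $x \in K$, the set $\{y \in K : F(x,y) < 0\}$ is convex; (A3) for every $y \in K$, the function $x \mapsto F(x,y)$ is upper semicontinuous on $K$. Then the equilibrium problem of finding $\bar x\in K$ such that $F(\bar x,y)\ge 0$ for every $y\in K$ has a solution, and its solution set $\mathcal{E}(K,F)$ is closed. In addition, if the function $x \mapsto F(x,y)$ is quasi-concave for every fixed $y \in K$, then $\mathcal{E}(K,F)$ is convex.
   Context: A Hadamard space is a complete CAT(0) space. For $x,y\in X$, $\gamma_{x,y}:[0,1]\to X$ is the normalized (constant speed) geodesic from $x$ to $y$. A set is convex if it contains the geodesic segment joining any two of its points. A function $h:K\to\mathbb{R}$ on a convex set is quasi-convex if $h\circ\gamma_{x,y}:[0,1]\to\mathbb{R}$ is quasi-convex for all $x,y\in K$, and quasi-concave if $-h$ is quasi-convex. $\mathcal{E}(K,F) := \{\bar x\in K : F(\bar x,y)\ge 0 \ \forall y\in K\}$. *)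

(* Defs.v *)
From HB Require Import structures.
From mathcomp Require Import all_boot all_order all_algebra.
From mathcomp Require Import all_classical all_reals all_analysis.

Set Implicit Arguments.
Unset Strict Implicit.
Unset Printing Implicit Defensive.

Import Order.TTheory GRing.Theory Num.Theory.

Local Open Scope classical_set_scope.
Local Open Scope ring_scope.

(* The library's cvg and completeType require a pointed type, which X need not
   be. *)
Definition complete_space (R : realType) (X : metricType R) : Prop :=
  forall G : set_system X, ProperFilter G -> cauchy G ->
    exists l : X, G --> l.

(* Constant-speed geodesic from x to y; only the values of c on [0, 1]
   matter. *)
Definition is_geodesic (R : realType) (X : metricType R)
    (x y : X) (c : R -> X) : Prop :=
  [/\ c 0 = x, c 1 = y &
      forall s t : R, s \in `[0, 1] -> t \in `[0, 1] ->
        mdist (c s) (c t) = `|s - t| * mdist x y].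

Definition geodesic_space (R : realType) (X : metricType R) : Prop :=
  forall x y : X, exists c : R -> X, is_geodesic x y c.

(* The library norm on row vectors is the sup norm, hence this definition. *)
Definition euclidean_dist (R : realType) (u v : 'rV[R]_2) : R :=
  Num.sqrt (\sum_(i < 2) (u 0 i - v 0 i) ^+ 2).

Definition plane_segment (R : realType) (u v : 'rV[R]_2) (t : R) : 'rV[R]_2 :=
  (1 - t) *: u + t *: v.

(* A geodesic triangle is given by vertices v 0, v 1, v 2 and sides c i joining
   v i to v (i + 1), with addition in 'I_3 modulo 3; w is a comparison triangle
   for it in the Euclidean plane. *)
Definition cat0 (R : realType) (X : metricType R) : Prop :=
  geodesic_space X /\
  forall (v : 'I_3 -> X) (c : 'I_3 -> R -> X) (w : 'I_3 -> 'rV[R]_2),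
    (forall i, is_geodesic (v i) (v (i + 1)) (c i)) ->
    (forall i, euclidean_dist (w i) (w (i + 1)) = mdist (v i) (v (i + 1))) ->
    forall (i j : 'I_3) (s t : R), s \in `[0, 1] -> t \in `[0, 1] ->
      mdist (c i s) (c j t) <=
        euclidean_dist (plane_segment (w i) (w (i + 1)) s)
                       (plane_segment (w j) (w (j + 1)) t).

Definition hadamard (R : realType) (X : metricType R) : Prop :=
  complete_space X /\ cat0 X.

(* In a CAT(0) space the geodesic c from x to y is unique on [0, 1], so
   quantifying over all such c here and in quasi_convex_on amounts to taking
   the geodesic. *)
Definition geodesically_convex (R : realType) (X : metricType R)
    (K : set X) : Prop :=
  forall (x y : X) (c : R -> X), K x -> K y -> is_geodesic x y c ->
    forall t : R, t \in `[0, 1] -> K (c t).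

Definition quasi_convex_unit (R : realType) (phi : R -> R) : Prop :=
  forall s t a : R, s \in `[0, 1] -> t \in `[0, 1] -> a \in `[0, 1] ->
    phi ((1 - a) * s + a * t) <= Num.max (phi s) (phi t).

Definition quasi_convex_on (R : realType) (X : metricType R)
    (K : set X) (h : X -> R) : Prop :=
  forall (x y : X) (c : R -> X), K x -> K y -> is_geodesic x y c ->
    quasi_convex_unit (h \o c).

Definition quasi_concave_on (R : realType) (X : metricType R)
    (K : set X) (h : X -> R) : Prop :=
  quasi_convex_on K (fun x => - h x).

(* Upper semicontinuity for the subspace topology of K. *)
Definition upper_semicontinuous_on (R : realType) (X : metricType R)
    (K : set X) (h : X -> R) : Prop :=
  forall (x : X) (a : R), K x -> h x < a ->
    \forall z \near within K (nbhs x), h z < a.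

(* A bifunction on K is the restriction to K of a function on X; no definition
   or hypothesis looks at its values outside K. *)
Definition equilibria (R : realType) (X : metricType R)
    (K : set X) (F : X -> X -> R) : set X :=
  [set x | K x /\ forall y, K y -> 0 <= F x y].

(* Main.v *)
(* The bifunction is handled through a Scarf-type combinatorial lemma, which
   plays the role of Brouwer's theorem without any simplices.  Given finitely
   many points j of K, each carrying a point y_j of K, rank the points, for each
   index i, by their closeness to y_i.  The lemma yields a nonempty set s of
   indices such that no point lies closer to every y_i (i in s) than all points
   of s do.  If the points form a fine net of K, uniform convexity of the CAT(0)
   metric forces s to have small diameter, and projecting onto the convex hull of
   the y_i (i in s), which decreases all distances to the y_i, shows that this
   hull comes close to s.

   If there is no equilibrium, compactness and upper semicontinuity give d > 0
   and y_x for each x with F(z, y_x) < 0 as soon as rho(x, z) < d.  A point p of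
   the hull that is d-close to all of s then satisfies F(p, y_i) < 0 for all i in
   s, hence F(p, p) < 0 by (A2), contradicting (A1). *)
Require Import Defs.
From HB Require Import structures.
From mathcomp Require Import all_boot all_order all_algebra.
From mathcomp Require Import ring lra.
Set Implicit Arguments.
Unset Strict Implicit.
Unset Printing Implicit Defensive.

Import Order.TTheory GRing.Theory Num.Theory.

(** * A Scarf-type combinatorial lemma, by a parity count *)

Section Scarf.
Local Open Scope order_scope.
Context {d : Order.disp_t} {O : orderType d}.

(* In the terminology of Petri and Voorneveld, a dominant pair (s, C) is a room
   when #|C| = #|s| and a door when #|C| = #|s| + 1. *)
Definition dominant (T I : finType) (f : I -> T -> O)
    (s : {set T}) (C : {set I}) : bool :=
  [forall j, [exists i in C, [forall x in s, f i j <= f i x]]].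

Lemma dominantP (T I : finType) (f : I -> T -> O) (s : {set T}) (C : {set I}) :
  reflect (forall j, exists2 i, i \in C & forall x, x \in s -> f i j <= f i x)
          (dominant f s C).
Proof.
apply: (iffP forallP) => [h j | h j].
  by have /exists_inP[i iC /forall_inP hi] := h j; exists i.
by have [i iC hi] := h j; apply/exists_inP; exists i => //; apply/forall_inP.
Qed.

Lemma dominantS (T I : finType) (f : I -> T -> O) (s s' : {set T})
    (C C' : {set I}) :
  s' \subset s -> C \subset C' -> dominant f s C -> dominant f s' C'.
Proof.
move=> /subsetP ss /subsetP CC /dominantP h; apply/dominantP => j.
by have [i iC hi] := h j; exists i => [|x xs]; [exact: CC | exact/hi/ss].
Qed.

(* A door with t nonempty opens into exactly two rooms.  Two indices a and b of D
   share their minimiser in t, and each of them accounts for one room: e is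
   removed from D if this keeps dominance, and otherwise the f e-largest point
   beating t for all other indices is added to t. *)
Lemma card_dominant_neighbours (T I : finType) (f : I -> T -> O)
    (t : {set T}) (D : {set I}) :
  (forall i, injective (f i)) -> t != set0 -> dominant f t D ->
  #|D| = #|t|.+1 ->
  (#|[set x | (x \notin t) && dominant f (x |: t) D]|
   + #|[set i in D | dominant f t (D :\ i)]| = 2)%N.
Proof.
move=> finj /set0Pn[x0 x0t] domtD cardD.
pose m i := [arg min_(x < x0 in t) f i x].
have mt i : m i \in t by rewrite /m; case: arg_minP.
have mle i x : x \in t -> f i (m i) <= f i x.
  by rewrite /m; case: arg_minP => // y _ + xt; apply.
have muniq i y : y \in t -> (forall x, x \in t -> f i y <= f i x) -> y = m i.
  by move=> yt hy; apply: (finj i); apply/le_anti; rewrite mle // hy.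
have msurj C : (forall y, y \in t -> exists2 i, i \in C &
    forall x, x \in t -> f i y <= f i x) -> m @: C = t.
  move=> h; apply/setP => y; apply/imsetP/idP => [[i _ ->] // | yt].
  by have [i iC hi] := h y yt; exists i => //; exact: muniq.
have msurj_dom C : dominant f t C -> m @: C = t.
  by move=> /dominantP h; apply: msurj => y _; exact: h.
have minj e : e \in D -> m @: (D :\ e) = t -> {in D :\ e &, injective m}.
  move=> eD h; apply/imset_injP; rewrite h.
  by have := cardsD1 e D; rewrite eD cardD => -[->].
(* [m] maps [D] onto [t], which has one element fewer. *)
have /dinjectivePn[a aD [b]] : ~~ dinjectiveb m D.
  apply/negP => /dinjectiveP/imset_injP.
  by rewrite msurj_dom // cardD ltn_eqF.
rewrite !inE => /andP[bNa bD] mab.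
(* A surjection of [D :\ e] onto [t] is a bijection, so it cannot keep both [a] and [b]. *)
have exceptional e : e \in D -> m @: (D :\ e) = t -> e \in [set a; b].
  move=> eD /(minj _ eD) inj; rewrite !inE; apply: contraNT bNa.
  rewrite negb_or => /andP[ea eb]; apply/eqP/inj; rewrite ?inE ?mab //.
    by rewrite bD eq_sym eb.
  by rewrite aD eq_sym ea.
have ED e : e \in [set a; b] -> e \in D.
  by rewrite !inE => /orP[] /eqP->.
have twin e : e \in [set a; b] -> exists2 e', e' \in D :\ e & m e = m e'.
  rewrite !inE => /orP[] /eqP->; [exists b|exists a] => //.
    by rewrite !inE bNa.
  by rewrite !inE eq_sym bNa.
(* The points left undominated once [e] is removed from [D]. *)
pose M e := [set j | [forall i in D :\ e, f i (m i) < f i j]].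
have inM e j : reflect (forall i, i \in D :\ e -> f i (m i) < f i j)
                       (j \in M e).
  by rewrite inE; apply: (iffP forall_inP).
have notinM e j : j \notin M e -> exists2 i, i \in D :\ e & f i j <= f i (m i).
  rewrite in_set => /forall_inPn[i iDe]; rewrite -leNgt => hi.
  by exists i.
have domt j : exists2 i, i \in D & f i j <= f i (m i).
  by have /dominantP/(_ j)[i iD hi] := domtD; exists i => //; exact: hi.
have Mle e j : j \in M e -> f e j <= f e (m e).
  move=> /inM jM; have [i iD hi] := domt j.
  case: (eqVneq i e) hi => [-> //|ie]; rewrite leNgt jM //.
  by rewrite !inE ie.
have M0 e : e \in [set a; b] -> dominant f t (D :\ e) = (M e == set0).
  move=> eE; apply/idP/eqP => [/dominantP h|M0].
    apply/setP => j; rewrite in_set0; apply/negP => /inM jM.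
    have [i iD hi] := h j; have := hi _ (mt i).
    by rewrite leNgt jM.
  apply/dominantP => j; have [|i iD hi] := notinM e j; first by rewrite M0 in_set0.
  by exists i => // x xt; exact: le_trans hi (mle _ _ xt).
have /fin_all_exists[top topP] e : exists x, M e != set0 ->
    x \in M e /\ forall j, j \in M e -> f e j <= f e x.
  case: (set_0Vmem (M e)) => [->|[j jM]]; first by exists x0; rewrite eqxx.
  by case: (arg_maxP (f e) jM) => x xM hx; exists x.
have setsP : [set x | (x \notin t) && dominant f (x |: t) D]
           = top @: [set e in [set a; b] | M e != set0].
  apply/setP => x; apply/idP/imsetP; rewrite !inE.
    move=> /andP[xt /dominantP h].
    have [e eD xe] := h x.
    have neq_min s i : s \in t -> (forall y, y \in x |: t -> f i s <= f i y) ->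
        i != e.
      move=> st si; apply: contraNneq xt => ie; rewrite ie in si.
      suff -> : x = s by [].
      apply: (finj e); apply/le_anti; rewrite xe ?si ?setU11 //.
      by rewrite !inE st orbT.
    (* Each point of [t] is the minimiser over [x |: t] of some index, never of [e], whose minimiser
       is [x]. *)
    have surj : m @: (D :\ e) = t.
      apply: msurj => s st; have [i iD hi] := h s.
      exists i => [|y yt]; last by apply: hi; rewrite !inE yt orbT.
      by rewrite !inE iD andbT (neq_min s).
    have eE := exceptional e eD surj.
    have xM : x \in M e.
      apply/inM => i iDe; rewrite lt_neqAle; apply/andP; split.
        by apply: contraNneq xt => /finj <-.
      have [i' i'D hi'] := h (m i).
      have ii' : i = i'.
        apply: (minj e eD surj) => //; first by rewrite !inE i'D (neq_min (m i)).
        apply: muniq => // y yt.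
        by apply: hi'; rewrite !inE yt orbT.
      by rewrite {1}ii' -ii'; move: (hi' x (setU11 _ _)); rewrite -ii'.
    have Mn0 : M e != set0 by apply/set0Pn; exists x.
    exists e; first by rewrite !inE Mn0 andbT; move: eE; rewrite !inE.
    have [tM tmax] := topP e Mn0.
    apply: (finj e); apply/le_anti; rewrite tmax //=.
    have [i iD hi] := h (top e).
    case: (eqVneq i e) hi => [-> hi|ie hi]; first by apply: hi; rewrite setU11.
    have : f i (top e) <= f i (m i) by apply: hi; rewrite !inE mt orbT.
    by rewrite leNgt; move/inM: tM => -> //; rewrite !inE ie.
  move=> [e]; rewrite !inE => /andP[eE Mn0] ->{x}.
  have {}eE : e \in [set a; b] by rewrite !inE.
  have [tM tmax] := topP e Mn0; move/inM: (tM) => tM'.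
  apply/andP; split.
    apply/negP => tt; have [i iD hi] := domt (top e).
    case: (eqVneq i e) => ie; last first.
      by move: hi; rewrite leNgt tM' // !inE ie.
    have te : top e = m e.
      by rewrite ie in hi; apply: muniq => // y yt; exact: le_trans hi (mle _ _ yt).
    have [e' e'D me] := twin e eE.
    by have := tM' e' e'D; rewrite te me ltxx.
  apply/dominantP => j; case: (boolP (j \in M e)) => jM.
    exists e => [|x]; first exact: ED.
    rewrite !inE => /orP[/eqP ->|xt]; first exact: tmax.
    exact: le_trans (Mle _ _ jM) (mle _ _ xt).
  have [i iDe hi] := notinM e j jM.
  exists i => [|x]; first by move: iDe; rewrite !inE => /andP[].
  rewrite !inE => /orP[/eqP ->|xt]; last exact: le_trans hi (mle _ _ xt).
  exact/(le_trans hi)/ltW/tM'.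
(* [top e] determines [e]: some index of [D] dominates it, and none other than [e] can. *)
have top_inj : {in [set e in [set a; b] | M e != set0] &, injective top}.
  move=> e e'; rewrite !in_set => /andP[_ /topP[/inM tM _]].
  move=> /andP[_ /topP[/inM tM' _]] tt.
  have [i iD hi] := domt (top e).
  have -> : e = i.
    apply/esym/eqP; apply: contraTT hi => ie.
    by rewrite -ltNge tM // !inE ie.
  apply/eqP; apply: contraTT hi => ie.
  by rewrite -ltNge tt tM' // !inE ie.
have -> : [set i in D | dominant f t (D :\ i)]
        = [set e in [set a; b] | M e == set0].
  apply/setP => e; rewrite [LHS]in_set [RHS]in_set.
  apply/andP/andP => -[h1 h2]; last by rewrite M0 // ED.
  have eE := exceptional e h1 (msurj_dom _ h2).
  by rewrite -M0.
have card_ab : #|[set a; b]| = 2 by rewrite cards2 eq_sym bNa.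
rewrite setsP card_in_imset // -[RHS]card_ab.
rewrite -(cardsID [set e | M e == set0] [set a; b]) addnC.
by congr (_ + _)%N; apply: eq_card => e; rewrite !inE // andbC.
Qed.

(* Parity: fix o and count, over the doors (t, o |: t) with o \notin t, the rooms
   they open into.  The door with t = set0 has one, all others have two, so the
   total is odd.  Without a dominant (s, s), every such room (x |: t, o |: t)
   belongs to the two doors given by t and x |: t, so the total is even. *)
Lemma exists_dominant (T : finType) (f : T -> T -> O) :
  (forall i, injective (f i)) -> (0 < #|T|)%N ->
  exists2 s : {set T}, s != set0 & dominant f s s.
Proof.
move=> finj /card_gt0P[o _].
case: (boolP [exists s : {set T}, (s != set0) && dominant f s s]).
  by case/existsP => s /andP[]; exists s.
move=> /existsPn none.
have notdom s : dominant f s s = false.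
  apply/negP => hs; have := none s; rewrite hs andbT negbK => /eqP s0.
  by move/dominantP/(_ o) : hs => -[i]; rewrite s0 inE.
pose S := [set t : {set T} | (o \notin t) && dominant f t (o |: t)].
pose up (t : {set T}) := [set x | (x \notin t) && dominant f (x |: t) (o |: t)].
pose down (t : {set T}) := [set i in o |: t | dominant f t ((o |: t) :\ i)].
have deg0 : (#|up set0| + #|down set0| = 1)%N.
  have [x _ xmax] := arg_maxP (f o) (isT : predT o).
  have {}xmax y : f o y <= f o x by exact: xmax.
  have -> : up set0 = [set x].
    apply/setP => y; rewrite !inE setU0 /= !setU0.
    apply/dominantP/eqP => [/(_ x)[i] | -> j].
      rewrite inE => /eqP-> /(_ y (set11 y)) xy.
      by apply: (finj o); apply/le_anti; rewrite xy xmax.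
    by exists o => [|z]; rewrite inE // => /eqP->; exact: xmax.
  have -> : down set0 = set0.
    apply/setP => i; rewrite !inE orbF; apply/negP => /andP[/eqP-> /dominantP].
    by move=> /(_ o)[j]; rewrite !inE orbF => /andP[/negPf->].
  by rewrite cards1 cards0.
have S0 : set0 \in S.
  rewrite !inE /=; apply/dominantP => j; exists o => [|x].
    by rewrite setU11.
  by rewrite inE.
have sum_odd : odd (\sum_(t in S) (#|up t| + #|down t|)).
  rewrite (bigD1 set0) //= deg0 (eq_bigr (fun=> 2%N)); last first.
    move=> t /andP[]; rewrite inE => /andP[ot dt] t0.
    by apply: card_dominant_neighbours => //; rewrite cardsU1 ot.
  by rewrite sum_nat_const muln2 oddD odd_double.
suff : \sum_(t in S) #|up t| = \sum_(t in S) #|down t|.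
  by move=> e; move: sum_odd; rewrite big_split /= e addnn odd_double.
have card_sum (P : {set T} -> {set T}) :
    \sum_(t in S) #|P t| = \sum_x #|[set t in S | x \in P t]|.
  under eq_bigr do rewrite -sum1_card big_mkcond /=.
  rewrite exchange_big /=; apply: eq_bigr => x _.
  by rewrite -sum1dep_card big_mkcondr.
rewrite !card_sum; apply: eq_bigr => x _.
have -> : [set t in S | x \in down t]
        = (fun t => x |: t) @: [set t in S | x \in up t].
  apply/setP => u; rewrite !inE; apply/idP/imsetP.
    move=> /andP[/andP[ou du] /andP[xu dx]].
    (* The case [x = o] is impossible: it would make [(u, u)] dominant. *)
    case: (eqVneq x o) => [xo|xo] in xu dx *.
      by move: dx; rewrite xo setU1K // notdom.
    rewrite /= in xu.
    have E : o |: (u :\ x) = (o |: u) :\ x.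
      apply/setP => y; rewrite !inE; case: (eqVneq y x) => // ->.
      by rewrite (negPf xo).
    exists (u :\ x); last by rewrite setD1K.
    rewrite !inE eqxx /= (negPf ou) andbF /= setD1K // E dx andbT.
    exact: dominantS (subD1set u x) (subxx _) dx.
  move=> [t]; rewrite !inE => /andP[/andP[ot dt] /andP[xt dx]] ->.
  have xo : x != o by apply: contraTneq dx => ->; rewrite notdom.
  rewrite !inE eqxx orbT /= negb_or eq_sym xo ot /=.
  have -> : (o |: (x |: t)) :\ x = o |: t.
    apply/setP => y; rewrite !inE; case: (eqVneq y x) => // ->.
    by rewrite (negPf xo) (negPf xt).
  rewrite dx andbT.
  by apply: dominantS dx => //; apply/setUS/subsetUr.
rewrite card_in_imset // => t t'; rewrite !inE => /andP[_ /andP[xt _]].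
by move=> /andP[_ /andP[xt' _]] e; rewrite -(setU1K xt) e setU1K.
Qed.
End Scarf.

(** Breaking ties by enumeration rank makes every ranking injective; dominance for the lexicographic
    order implies dominance for [f]. *)
Lemma exists_weakly_dominant (d : Order.disp_t) (O : orderType d) (T : finType)
    (f : T -> T -> O) :
  (0 < #|T|)%N -> exists2 s : {set T}, s != set0 & dominant f s s.
Proof.
move=> T0.
pose g i x : (O *l nat)%type := (f i x, nat_of_ord (enum_rank x)).
have ginj i : injective (g i) by move=> x y [_] /ord_inj/enum_rank_inj.
have [s s0 /dominantP ds] := exists_dominant ginj T0.
exists s => //; apply/dominantP => j; have [i iS h] := ds j.
by exists i => // x /h; rewrite leEprodlexi => /andP[].
Qed.

From mathcomp Require Import all_classical all_reals all_analysis.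

Local Open Scope classical_set_scope.
Local Open Scope ring_scope.

(** * Euclidean comparison triangles and the CAT(0) inequality *)

Definition plane_point (R : realType) (x y : R) : 'rV[R]_2 :=
  \row_i (if i == 0 then x else y).

Lemma euclidean_dist_plane_point (R : realType) (a b a' b' : R) :
  euclidean_dist (plane_point a b) (plane_point a' b')
    = Num.sqrt ((a - a') ^+ 2 + (b - b') ^+ 2).
Proof. by rewrite /euclidean_dist big_ord_recr big_ord1 /= !mxE. Qed.

Lemma plane_segment_plane_point (R : realType) (a b a' b' t : R) :
  plane_segment (plane_point a b) (plane_point a' b') t
    = plane_point ((1 - t) * a + t * a') ((1 - t) * b + t * b').
Proof. by apply/rowP => i; rewrite !mxE; case: ifP. Qed.

(** One side runs from the origin to [(a, 0)]. For nonzero [a] the law of cosines fixes [u], and the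
    triangle inequalities give [u ^+ 2 <= b ^+ 2], so that [v] exists. *)
Lemma comparison_vertex (R : realType) (a b c : R) :
  0 <= a -> 0 <= b -> 0 <= c -> a <= b + c -> b <= a + c -> c <= a + b ->
  exists u v : R, u ^+ 2 + v ^+ 2 = b ^+ 2 /\ (u - a) ^+ 2 + v ^+ 2 = c ^+ 2.
Proof.
move=> a0 b0 c0 abc bac cab; have [az|an0] := eqVneq a 0.
  have bc : b = c by lra.
  by exists b, 0; rewrite az bc; split; ring.
pose u := (a ^+ 2 + b ^+ 2 - c ^+ 2) / (2 * a).
have ua : 2 * a * u = a ^+ 2 + b ^+ 2 - c ^+ 2.
  by rewrite /u mulrC divfK // mulf_neq0 // pnatr_eq0.
have ap : 0 < a by rewrite lt_neqAle eq_sym an0.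
have ub : u ^+ 2 <= b ^+ 2.
  have h1 : 0 <= b - u.
    rewrite -(pmulr_rge0 _ ap).
    have : 0 <= (c - (a - b)) * (c + (a - b)) by apply: mulr_ge0; lra.
    lra.
  have h2 : 0 <= b + u.
    rewrite -(pmulr_rge0 _ ap).
    have : 0 <= (a + b - c) * (a + b + c) by apply: mulr_ge0; lra.
    lra.
  by have := mulr_ge0 h1 h2; lra.
exists u, (Num.sqrt (b ^+ 2 - u ^+ 2)); rewrite sqr_sqrtr; last by lra.
by split; lra.
Qed.

(* The Bruhat-Tits inequality: comparison of the median with the Euclidean one,
   for which equality is Stewart's theorem. *)
Lemma cat0_CN (R : realType) (X : metricType R) (x y p : X) (c : R -> X) (t : R) :
  cat0 X -> is_geodesic x y c -> t \in `[0, 1] ->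
  mdist (c t) p ^+ 2 <= (1 - t) * mdist x p ^+ 2 + t * mdist y p ^+ 2
                        - t * (1 - t) * mdist x y ^+ 2.
Proof.
move=> [geo cmp] cg t01.
have [c1 c1g] := geo y p; have [c2 c2g] := geo p x.
have [||||||u [v [uv1 uv2]]] :=
  @comparison_vertex R (mdist x y) (mdist x p) (mdist y p); rewrite ?mdist_ge0 //.
- by rewrite (metric_sym y p) metric_triangle.
- exact: metric_triangle.
- by rewrite (metric_sym x y) metric_triangle.
pose V (i : 'I_3) := if val i is 0%N then x else if val i is 1%N then y else p.
pose C (i : 'I_3) := if val i is 0%N then c else if val i is 1%N then c1 else c2.
pose W (i : 'I_3) := if val i is 0%N then plane_point 0 0
  else if val i is 1%N then plane_point (mdist x y) 0 else plane_point u v.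
have VC i : is_geodesic (V i) (V (i + 1)) (C i).
  by case: i => [[|[|[|//]]]].
have WV i : euclidean_dist (W i) (W (i + 1)) = mdist (V i) (V (i + 1)).
  have sqrtE (r s : R) : 0 <= r -> s = r ^+ 2 -> Num.sqrt s = r.
    by move=> r0 ->; rewrite sqrtr_sqr ger0_norm.
  case: i => [[|[|[|//]]]] h; rewrite /W /V /= euclidean_dist_plane_point;
    apply: sqrtE; rewrite ?mdist_ge0 //; first by ring.
  - by rewrite -uv2; ring.
  - by rewrite metric_sym -uv1; ring.
(* In ['I_3], [-1] is the index 2, whose side starts at [p]. *)
have := cmp V C W VC WV 0 (-1) t 0 t01.
rewrite in_itv /= lexx ler01 => /(_ isT).
have -> : C (-1) 0 = p by have [+ _ _] := c2g.
rewrite /W /= !plane_segment_plane_point euclidean_dist_plane_point => h.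
apply: (le_trans (_ : _ <= Num.sqrt _ ^+ 2)).
  by rewrite ler_pXn2r ?nnegrE ?mdist_ge0 ?sqrtr_ge0 //; exact: h.
rewrite sqr_sqrtr ?addr_ge0 ?sqr_ge0 // -uv2 -uv1.
lra.
Qed.

(** * Bounds and finite nets from compactness *)

Lemma compact_mdist_bounded (R : realType) (X : metricType R) (K : set X) :
  compact K -> exists2 D : R, 1 <= D &
    forall x y, K x -> K y -> mdist x y <= D.
Proof.
move=> Kc; have [->|/set0P[x0 Kx0]] := eqVneq K set0; first by exists 1.
have /compact_near_coveringP/(_ _ (+oo)%R (fun M z => mdist x0 z < M)) := Kc.
case=> [x _|M [_ hM]].
  exists (ball x 1, [set M | mdist x0 x + 1 < M]) => [/=|[z M] [/= xz xM]].
    split; first exact: nbhsx_ballx.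
    by exists (mdist x0 x + 1); split => //; exact: num_real.
  rewrite (le_lt_trans _ xM) // (le_trans (metric_triangle _ x _)) //.
  by rewrite lerD2l; move: xz; rewrite ballEmdist /= => /ltW.
pose N := Num.max M 1 + 1.
have hN z : K z -> mdist x0 z < N.
  apply: hM; rewrite (@le_lt_trans _ _ (Num.max M 1)) ?le_max ?lexx //.
  by rewrite ltrDl.
exists (N + N) => [|x y Kx Ky]; first by have := le_max 1 M 1; rewrite /N lexx orbT; lra.
rewrite (le_trans (metric_triangle _ x0 _)) // metric_sym.
by rewrite lerD // ltW ?hN.
Qed.

Lemma compact_finite_net (R : realType) (X : metricType R) (K : set X) (e : R) :
  compact K -> 0 < e -> exists2 s : seq X, (forall x, x \in s -> K x) &
    forall z, K z -> exists2 x, x \in s & mdist x z < e.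
Proof.
move=> Kc e0.
(* Finite families in [K], directed by inclusion, generate a filter to which the near-covering form
   of compactness applies. *)
pose supersets (s : seq X) :=
  [set s' : seq X | {subset s <= s'} /\ forall x, x \in s' -> K x].
pose inK := [set s : seq X | forall x, x \in s -> K x].
have FF : Filter (filter_from inK supersets).
  apply: filter_from_filter; first by exists [::].
  move=> s s' sK s'K; exists (s ++ s').
    by move=> x; rewrite mem_cat => /orP[/sK|/s'K].
  by move=> r [ssr rK]; split; split => // x xs; apply: ssr; rewrite mem_cat xs ?orbT.
have /compact_near_coveringP/(_ _ _
  (fun (s : seq X) z => exists2 x, x \in s & mdist x z < e) FF) := Kc.
case=> [x Kx|s sK hs]; last by exists s => //; exact: (hs s (conj (fun _ => id) sK)).
exists (ball x e, supersets [:: x]) => [|[z s] [/= xz [xs _]]].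
  split; first exact: nbhsx_ballx.
  by exists [:: x] => // z; rewrite inE => /eqP->.
by exists x; [apply: xs; rewrite inE | move: xz; rewrite ballEmdist].
Qed.

(** * Convex hulls, approximate projections and approximate fixed points *)

Definition geodesic_hull (R : realType) (X : metricType R) (A : set X) : set X :=
  [set p | forall B : set X, A `<=` B -> geodesically_convex B -> B p].

Lemma sub_geodesic_hull (R : realType) (X : metricType R) (A : set X) :
  A `<=` geodesic_hull A.
Proof. by move=> x Ax B AB _; exact: AB. Qed.

Lemma geodesic_hull_convex (R : realType) (X : metricType R) (A : set X) :
  geodesically_convex (geodesic_hull A).
Proof.
move=> x y c hx hy cg t t01 B AB Bc.
exact: (Bc x y c (hx B AB Bc) (hy B AB Bc) cg).
Qed.

Lemma approximate_nearest_point (R : realType) (X : metricType R) (H : set X)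
    (x : X) (e : R) :
  H !=set0 -> 0 < e ->
  exists2 p, H p & forall q, H q -> mdist p x ^+ 2 <= mdist q x ^+ 2 + e.
Proof.
move=> [h0 Hh0] e0; pose A := [set mdist q x ^+ 2 | q in H].
have Ainf : has_inf A.
  split; first by exists (mdist h0 x ^+ 2), h0.
  by exists 0 => _ [q _ <-]; exact: sqr_ge0.
have [_ [p Hp <-] pe] := inf_adherent e0 Ainf.
exists p => // q Hq; rewrite (le_trans (ltW pe)) // lerD2r.
by apply: ge_inf; [case: Ainf | exists q].
Qed.

(* The analogue of the obtuse angle property of a metric projection; it is kept
   approximate because a convex hull need not be closed. *)
Lemma approximate_projection (R : realType) (X : metricType R) (H : set X)
    (x p y : X) (D e t : R) :
  cat0 X -> geodesically_convex H -> H p -> H y -> 0 < t -> t <= 1 ->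
  mdist p y <= D -> t * D ^+ 2 <= e ->
  (forall q, H q -> mdist p x ^+ 2 <= mdist q x ^+ 2 + t * e) ->
  mdist p x ^+ 2 + mdist p y ^+ 2 <= mdist x y ^+ 2 + 2 * e.
Proof.
move=> Xcat Hc Hp Hy t0 t1 pyD tD pmin.
(* Moving from [p] by a fraction [t] towards [y] stays in [H]. Near-minimality and [cat0_CN],
   divided by [t], leave the error [e + t * r <= 2 * e]. *)
have [c cg] := Xcat.1 p y.
have t01 : t \in `[0, 1] by rewrite in_itv /= ltW.
have := cat0_CN x Xcat cg t01.
have := pmin (c t) (Hc p y c Hp Hy cg t t01).
rewrite (metric_sym x y); set a := mdist (c t) x ^+ 2; set b := mdist p x ^+ 2.
set r := mdist p y ^+ 2; set q := mdist y x ^+ 2 => h1 h2.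
have rD : r <= D ^+ 2 by rewrite /r ler_pXn2r ?nnegrE ?mdist_ge0 // (le_trans _ pyD) ?mdist_ge0.
have tr : t * r <= e by rewrite (le_trans _ tD) // ler_pM2l.
have ttr : t * (t * r) <= t * e by rewrite ler_pM2l.
by rewrite -(ler_pM2l t0); lra.
Qed.

Lemma approximate_hull_fixed_point (R : realType) (X : metricType R) (K : set X)
    (y : X -> X) (d : R) :
  cat0 X -> K !=set0 -> compact K -> geodesically_convex K ->
  (forall x, K x -> K (y x)) -> 0 < d ->
  exists s p, [/\ s `<=` K, geodesic_hull (y @` s) p &
                  forall x, s x -> mdist x p < d].
Proof.
move=> Xcat [z0 Kz0] Kc Kconv yK d0.
have [D D1 KD] := compact_mdist_bounded Kc.
have D0 : 0 < D by lra.
pose m := Num.min d 1.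
have m0 : 0 < m by rewrite lt_min d0 ltr01.
have m1 : m <= 1 by rewrite ge_min lexx orbT.
(* The diameter of the dominant set and the projection distance will each be at most [2 * (m / 5)],
   with sum below [d]. *)
pose k := (m / 5) ^+ 2.
have k0 : 0 < k by rewrite exprn_gt0 // divr_gt0.
have k1 : k <= 1 by rewrite expr_le1 //; lra.
(* Since [e <= 1 <= D], an error [e] in a distance at most [D] raises its square by at most
   [2 * D * e + e ^+ 2 <= k]. *)
pose e := k / (3 * D).
have eD : 3 * (D * e) = k by rewrite /e; field; lra.
have e0 : 0 < e by rewrite divr_gt0 // mulr_gt0.
have e1 : e <= 1 by rewrite ler_pdivrMr; lra.
have [s sK snet] := compact_finite_net Kc e0.
have [n0 n0s _] := snet z0 Kz0.
(* The sign makes larger values mean closer points. *)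
have [|t] := @exists_weakly_dominant _ R (seq_sub s)
  (fun i j => - mdist (val j) (y (val i))).
  by apply/card_gt0P; exists (SeqSub n0s).
have valK (i : seq_sub s) : K (val i) by exact/sK/ssvalP.
move=> /set0Pn[i0 i0t] /dominantP tdom.
(* Dominance passes from the net to all of [K] at cost [k] in squared distance. *)
have dom q : K q -> exists2 i, i \in t & forall x, x \in t ->
    mdist (val x) (y (val i)) ^+ 2 <= mdist q (y (val i)) ^+ 2 + k.
  move=> Kq; have [n ns nq] := snet q Kq.
  have [i iT hi] := tdom (SeqSub ns); exists i => // x /hi.
  rewrite lerN2 /= => hx.
  have hxq : mdist (val x) (y (val i)) <= mdist q (y (val i)) + e.
    rewrite (le_trans hx) // (le_trans (metric_triangle _ q _)) //.
    by rewrite addrC lerD2l ltW.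
  have qD : mdist q (y (val i)) <= D by apply: KD => //; exact/yK.
  have q0 := mdist_ge0 q (y (val i)).
  apply: (@le_trans _ _ ((mdist q (y (val i)) + e) ^+ 2)).
    by rewrite ler_pXn2r ?nnegrE ?mdist_ge0 // addr_ge0 // ltW.
  have : mdist q (y (val i)) * e <= D * e by rewrite ler_pM2r.
  have : e * e <= D * e by rewrite ler_pM2r //; lra.
  lra.
have small u : 0 <= u -> u ^+ 2 <= 4 * k -> u <= 2 * (m / 5).
  move=> u0; have -> : 4 * k = (2 * (m / 5)) ^+ 2 by rewrite /k; ring.
  by rewrite ler_pXn2r // nnegrE; lra.
have diam x x' : x \in t -> x' \in t -> mdist (val x) (val x') <= 2 * (m / 5).
  move=> xt xt'; apply: small; first exact: mdist_ge0.
  (* By [dom], the midpoint is not much closer than both ends to some [y (val i)]; [cat0_CN] then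
     bounds a quarter of the squared distance by [k]. *)
  have [c cg] := Xcat.1 (val x) (val x').
  have h01 : 2^-1 \in `[0, 1 : R] by rewrite in_itv /=; lra.
  have [i iT hi] := dom _ (Kconv _ _ _ (valK x) (valK x') cg _ h01).
  have := cat0_CN (y (val i)) Xcat cg h01.
  have := hi x xt; have := hi x' xt'; lra.
pose H := geodesic_hull [set y x | x in [set val i | i in [set` t]]].
have HK : H `<=` K.
  by move=> p; apply => // _ [_ [i _ <-] <-]; exact/yK.
have Hy i : i \in t -> H (y (val i)).
  by move=> iT; apply: sub_geodesic_hull; exists (val i) => //; exists i.
(* The fraction [t] of [approximate_projection] for the error [k]. *)
pose r := k / D ^+ 2.
have rD : r * D ^+ 2 = k by rewrite /r divfK // expf_neq0 // gt_eqF.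
have r0 : 0 < r by rewrite divr_gt0 // exprn_gt0.
have r1 : r <= 1.
  rewrite ler_pdivrMr ?exprn_gt0 // mul1r (le_trans k1) // exprn_ege1 //.
have [p Hp pmin] := approximate_nearest_point (val i0)
  (ex_intro _ _ (Hy _ i0t)) (mulr_gt0 r0 k0).
exists [set val i | i in [set` t]], p; split => // [_ [i _ <-] //|_ [x xt <-]].
have p0 : mdist p (val i0) <= 2 * (m / 5).
  apply: small; first exact: mdist_ge0.
  (* For this [i], [val i0] is almost as close to [y (val i)] as [p] is; the projection inequality
     then gives [mdist p (val i0) ^+ 2 <= 3 * k]. *)
  have [i iT hi] := dom p (HK p Hp).
  have := approximate_projection Xcat (@geodesic_hull_convex _ _ _) Hp (Hy i iT)
    r0 r1 (KD _ _ (HK _ Hp) (yK _ (valK i))) _ pmin.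
  rewrite rD => /(_ (lexx _)); have := hi i0 i0t.
  lra.
have := metric_triangle (val x) (val i0) p; rewrite (metric_sym (val i0) p).
have := diam x i0 xt i0t.
have : m <= d by rewrite ge_min lexx.
lra.
Qed.

(** * Existence, closedness and convexity of the solution set *)

Lemma uniform_improvement (R : realType) (X : metricType R) (K : set X)
    (F : X -> X -> R) :
  compact K ->
  (forall y, K y -> upper_semicontinuous_on K (fun x => F x y)) ->
  equilibria K F = set0 ->
  exists2 d : R, 0 < d & forall x, K x -> exists2 y, K y &
    forall z, K z -> mdist x z < d -> F z y < 0.
Proof.
move=> Kc usc E0.
have /compact_near_coveringP/(_ _ (0 : R)^'+ (fun d x => exists2 y, K y &
    forall z, K z -> mdist x z < d -> F z y < 0)) := Kc.
case=> [x Kx|e /= e0 he]; last first.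
  exists (e / 2); first by rewrite divr_gt0.
  apply: he; rewrite /= ?divr_gt0 // sub0r normrN gtr0_norm ?divr_gt0 //.
  by rewrite ltr_pdivrMr // ltr_pMr // ltr1n.
have [y Ky Fxy] : exists2 y, K y & F x y < 0.
  apply: contrapT => h; suff : equilibria K F x by rewrite E0.
  by split => // y Ky; rewrite leNgt; apply/negP => Fxy; apply: h; exists y.
have /nbhs_ballP[r /= r0 hr] := usc y Ky x 0 Kx Fxy.
have r20 : 0 < r / 2 by rewrite divr_gt0.
exists (ball x (r / 2), [set e | e < r / 2]) => [/=|[z e] [/= xz er]].
  split; [exact: nbhsx_ballx | exact: nbhs_right_lt].
exists y => // w Kw zw; apply: hr => //; rewrite ballEmdist /=.
move: xz; rewrite ballEmdist /= => xz.
by have := metric_triangle x z w; lra.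
Qed.

Lemma equilibria_nonempty (R : realType) (X : metricType R) (K : set X)
    (F : X -> X -> R) :
  cat0 X -> K !=set0 -> compact K -> geodesically_convex K ->
  (forall x, K x -> 0 <= F x x) ->
  (forall x, K x -> geodesically_convex [set y | K y /\ F x y < 0]) ->
  (forall y, K y -> upper_semicontinuous_on K (fun x => F x y)) ->
  equilibria K F !=set0.
Proof.
move=> Xcat K0 Kc Kconv A1 A2 A3; apply/set0P/eqP => E0.
have [d d0 hd] := uniform_improvement Kc A3 E0.
have /choice[y yP] x : exists y, K x -> K y /\
    forall z, K z -> mdist x z < d -> F z y < 0.
  (* Outside [K] the value is a dummy. *)
  have [Kx|nKx] := pselect (K x); last by exists x.
  by have [y Ky hy] := hd x Kx; exists y.
have yK x : K x -> K (y x) by move=> /yP[].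
have [s [p [sK ps sd]]] := approximate_hull_fixed_point Xcat K0 Kc Kconv yK d0.
have Kp : K p by apply: ps => // _ [x /sK/yK Kyx <-].
have [_] : K p /\ F p p < 0.
  apply: (ps _ _ (A2 p Kp)) => _ [x sx <-]; split; first exact/yK/sK.
  by have [_] := yP x (sK x sx); apply => //; exact: sd.
by rewrite ltNge A1.
Qed.

(** A violation [F x y < 0] at a limit point would persist at nearby points of [K], among them an
    equilibrium. *)
Lemma equilibria_closed (R : realType) (X : metricType R) (K : set X)
    (F : X -> X -> R) :
  compact K ->
  (forall y, K y -> upper_semicontinuous_on K (fun x => F x y)) ->
  closed (equilibria K F).
Proof.
move=> Kc usc x clx.
have Kx : K x.
  apply: (compact_closed (@metric_hausdorff R X) Kc).
  by apply: closure_subset clx => z [].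
split => // y Ky; rewrite leNgt; apply/negP => Fxy.
have [z [[Kz /(_ y Ky) Fzy] hz]] := clx _ (usc y Ky x 0 Kx Fxy).
by have := hz Kz; rewrite ltNge Fzy.
Qed.

Lemma equilibria_convex (R : realType) (X : metricType R) (K : set X)
    (F : X -> X -> R) :
  geodesically_convex K ->
  (forall y, K y -> quasi_concave_on K (fun x => F x y)) ->
  geodesically_convex (equilibria K F).
Proof.
move=> Kconv qc x x' c [Kx Fx] [Kx' Fx'] cg t t01.
split; first exact: (Kconv x x' c).
move=> y Ky; have [c0 c1 _] := cg.
(* Between the parameters 0 and 1, quasi-concavity bounds [F (c t) y] below by the smaller end
   value. *)
have := qc y Ky x x' c Kx Kx' cg 0 1 t.
rewrite !in_itv /= lexx ler01 => /(_ isT).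
rewrite mulr0 add0r mulr1 c0 c1 lexx /= => /(_ isT t01).
move=> h; rewrite -oppr_le0 (le_trans h) // ge_max !oppr_le0.
by rewrite Fx ?Fx'.
Qed.

Theorem corollary4p2 (R : realType) (X : metricType R) (HX : hadamard X)
    (K : set X) (K_nonempty : K !=set0) (K_compact : compact K)
    (K_convex : geodesically_convex K) (F : X -> X -> R)
    (A1 : forall x, K x -> 0 <= F x x)
    (A2 : forall x, K x -> geodesically_convex [set y | K y /\ F x y < 0])
    (A3 : forall y, K y -> upper_semicontinuous_on K (fun x => F x y)) :
  [/\ equilibria K F !=set0,
      closed (equilibria K F) &
      (forall y, K y -> quasi_concave_on K (fun x => F x y)) ->
        geodesically_convex (equilibria K F)].
Proof.
have [_ Xcat] := HX; split.
- exact: equilibria_nonempty.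
- exact: equilibria_closed.
- exact: equilibria_convex.
Qed.
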